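(* Let $\mathcal A\subset\mathbb R^n$ be compact with diameter $D_{\mathcal A}<\infty$ and let $\mathcal X=\mathrm{conv}(\mathcal A)$ be $\alpha$-strongly convex for some $\alpha>0$. Let $f$ be convex and differentiable with $L$-Lipschitz gradient. Let $\{x_t\}_{t\ge0}$ be generated by the AC-FW algorithm with the closed-loop Frank-Wolfe subroutine and a damping sequence satisfying Condition (D), let $\eta\in(1,2)$, and let $\{h_t\}_{t\ge0}$ denote the elements of $\mathcal G\cap\mathcal I_\eta$ in increasing order. (i) If in addition $f$ is $\mu$-strongly convex for some $\mu>0$, then for any $t\ge0$, $$f(x_{h_t})-f(x^\star)\le\frac{\max\left\{\frac{LD_{\mathcal A}^2}{2},\ 18\left(\frac{1}{1+\sqrt{\eta/2}}\right)^2\left(\frac{\alpha\sqrt\mu}{8\sqrt2 L}\right)^{-2}\right\}\left(\frac{1}{1-\sqrt{\eta/2}}\right)^2}{\left(t+\frac{1}{1-\sqrt{\eta/2}}\right)^2}.$$ (ii) If in addition there is $g>0$ with $\|\nabla f(x)\|_2\ge g$ for all $x\in\mathcal X$, then for any $t\ge0$, $$f(x_{h_t})-f(x^\star)\le\frac{LD_{\mathcal A}^2}{2}\left(\max\left\{\frac{\eta}{2},\ 1-\left(1-\frac{\eta}{2}\right)\frac{\alpha g}{8L}\right\}\right)^t.$$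
   Context: $D_{\mathcal A}:=\sup_{x,y\in\mathcal A}\|x-y\|_2$; $\|\nabla f(x)-\nabla f(y)\|_2\le L\|x-y\|_2$ for all $x,y\in\mathbb R^n$. $x^\star$ is an optimal solution of $\min_{x\in\mathcal X}f(x)$. $\mathcal X$ is $\alpha$-strongly convex if for all $\rho\in[0,1]$, $x,y\in\mathcal X$ and $z\in\mathbb R^n$ with $\|z\|_2\le1$: $\rho x+(1-\rho)y+\frac{\rho(1-\rho)\alpha\|x-y\|_2^2}{2}z\in\mathcal X$. $f$ is $\mu$-strongly convex if $f(y)\ge f(x)+\nabla f(x)^\top(y-x)+\frac\mu2\|y-x\|_2^2$ for all $x,y$. For $x\ne y$, $\ell(x,y):=2|f(y)-f(x)-\nabla f(x)^\top(y-x)|/\|y-x\|_2^2$, $\ell(x,x):=0$. AC-FW algorithm with closed-loop Frank-Wolfe subroutine: given $\{r_t\}_{t\ge0}$, pick $x_{-1}\in\mathcal A$, $x_0\in\arg\min_{v\in\mathcal A}\nabla f(x_{-1})^\top v$, $L_0:=\ell(x_{-1},x_0)$. For $t=0,1,\dots$: $v_t\in\arg\min_{v\in\mathcal A}\nabla f(x_t)^\top v$; $d_t:=x_t-v_t$, $\gamma_t^{\max}:=1$; $\gamma_t:=\min\{\nabla f(x_t)^\top d_t/(L_t\|d_t\|_2^2),\gamma_t^{\max}\}$; $\bar x_{t+1}:=x_t-\gamma_td_t$; $L_{t+1}:=\max\{\ell(x_t,\bar x_{t+1}),r_tL_t\}$; $x_{t+1}:=\bar x_{t+1}$ if $f(\bar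 x_{t+1})<f(x_t)$, else $x_{t+1}:=x_t$. $\mathcal I_\eta:=\{t\ge0:L_{t+1}\le\eta L_t\}$; $\mathcal G:=\{t\ge0:\gamma_t^{\max}\ge1\text{ or }\gamma_t<\gamma_t^{\max}\}$ (here $\mathcal G=\mathbb Z_+$, so $\mathcal G\cap\mathcal I_\eta=\mathcal I_\eta$). Condition (D): $r_t\in(0,1]$ for all $t$ and $\prod_{t\ge0}r_t\in(0,1]$. *)

(* Defs.v *)
(* MathComp + MathComp-Analysis, over an abstract R : realType.
   Vectors of R^n are row vectors 'rV[R]_n; the Euclidean inner product and
   norm are defined explicitly below (the library norm on matrices is the
   max-norm). *)
From HB Require Import structures.
From mathcomp Require Import all_boot all_order all_algebra.
From mathcomp Require Import all_classical all_reals all_analysis.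
Set Implicit Arguments. Unset Strict Implicit. Unset Printing Implicit Defensive.
Import Order.TTheory GRing.Theory Num.Theory.
Import numFieldNormedType.Exports.
Local Open Scope classical_set_scope.
Local Open Scope ring_scope.

Section Defs.
Variables (R : realType) (n : nat).
Local Notation vec := 'rV[R]_n.

Definition dot (x y : vec) : R := \sum_(i < n) x ord0 i * y ord0 i.
Definition norm2 (x : vec) : R := Num.sqrt (dot x x).

Definition diam (A : set vec) : R :=
  sup [set d | exists x y, A x /\ A y /\ d = norm2 (x - y)].

Definition convhull (A : set vec) : set vec :=
  [set x | exists (m : nat) (lam : 'I_m -> R) (p : 'I_m -> vec),
      (forall i, 0 <= lam i) /\ \sum_(i < m) lam i = 1 /\
      (forall i, A (p i)) /\ x = \sum_(i < m) lam i *: p i].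

Definition strongly_convex_set (alpha : R) (X : set vec) : Prop :=
  forall (rho : R) (x y z : vec), 0 <= rho <= 1 -> X x -> X y -> norm2 z <= 1 ->
    X (rho *: x + (1 - rho) *: y
       + (rho * (1 - rho) * alpha * norm2 (x - y) ^+ 2 / 2) *: z).

Definition convex_fun (f : vec -> R) : Prop :=
  forall (x y : vec) (t : R), 0 <= t <= 1 ->
    f (t *: x + (1 - t) *: y) <= t * f x + (1 - t) * f y.

Definition is_gradient (f : vec -> R) (gf : vec -> vec) : Prop :=
  forall x, differentiable f x /\ forall h, 'd f x h = dot (gf x) h.

Definition lipschitz_grad (Lf : R) (gf : vec -> vec) : Prop :=
  forall x y, norm2 (gf x - gf y) <= Lf * norm2 (x - y).

Definition strongly_convex_fun (mu : R) (f : vec -> R) (gf : vec -> vec) : Prop :=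
  forall x y, f x + dot (gf x) (y - x) + mu / 2 * norm2 (y - x) ^+ 2 <= f y.

Definition is_minimizer (f : vec -> R) (X : set vec) (xs : vec) : Prop :=
  X xs /\ forall y, X y -> f xs <= f y.

Definition ell (f : vec -> R) (gf : vec -> vec) (x y : vec) : R :=
  if x == y then 0
  else 2 * `|f y - f x - dot (gf x) (y - x)| / norm2 (y - x) ^+ 2.

Definition is_argmin_lin (A : set vec) (c v : vec) : Prop :=
  A v /\ forall w, A w -> dot c v <= dot c w.

(* gamma_t := min { gap / (L_t ||d_t||^2), gamma^max = 1 }, with the
   convention gap / 0 = +oo (so gamma_t = 1 when L_t ||d_t||^2 = 0). *)
Definition stepsize (Lt : R) (d : vec) (gap : R) : R :=
  if Lt * norm2 d ^+ 2 == 0 then 1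
  else Num.min (gap / (Lt * norm2 d ^+ 2)) 1.

Definition ACFW_run (f : vec -> R) (gf : vec -> vec) (A : set vec)
    (r : nat -> R) (xm1 : vec) (x v : nat -> vec) (L : nat -> R) : Prop :=
  [/\ A xm1, is_argmin_lin A (gf xm1) (x 0%N), L 0%N = ell f gf xm1 (x 0%N) &
    forall t : nat,
      let d := x t - v t in
      let gam := stepsize (L t) d (dot (gf (x t)) d) in
      let xb := x t - gam *: d in
      [/\ is_argmin_lin A (gf (x t)) (v t),
          L t.+1 = Num.max (ell f gf (x t) xb) (r t * L t) &
          x t.+1 = if f xb < f (x t) then xb else x t]].

End Defs.

Definition condD (R : realType) (r : nat -> R) : Prop :=
  (forall t, 0 < r t <= 1) /\
  exists p : R, 0 < p <= 1 /\ (fun m : nat => \prod_(i < m) r i) @ \oo --> p.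

(* t in I_eta  (G = all of Z_+, so G cap I_eta = I_eta) *)
Definition inI (R : realType) (eta : R) (L : nat -> R) (u : nat) : bool :=
  L u.+1 <= eta * L u.

(* s = h_t : s is the t-th element (0-based) of G cap I_eta in increasing order *)
Definition is_h (R : realType) (eta : R) (L : nat -> R) (t s : nat) : Prop :=
  inI eta L s /\ count (inI eta L) (iota 0 s) = t.

(* Main.v *)
(** Write phi_t = f(x_t) - f(xstar), and let G_t be the Frank-Wolfe gap, so that
    phi_t <= G_t by convexity.  When L_{t+1} <= eta L_t, the local constant
    ell(x_t, xbar_{t+1}) is at most eta L_t, and the step min(G_t / (L_t |d_t|^2), 1)
    decreases f by at least (1 - eta/2) G_t min(1, G_t / (L_t |d_t|^2)).  Strong
    convexity of the hull gives G_t >= (alpha/4) |d_t|^2 |grad f(x_t)|, and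
    L_t <= L by smoothness, hence
      phi_{t+1} <= phi_t max(eta/2, 1 - (1 - eta/2) alpha |grad f(x_t)| / (4 L)).
    At the other iterations f does not increase.  Case (ii) follows at once;
    in case (i), |grad f(x_t)|^2 >= 2 mu phi_t turns this into a recursion on
    phi_t alone. *)
Require Import Defs.
From HB Require Import structures.
From mathcomp Require Import all_boot all_order all_algebra.
From mathcomp Require Import all_classical all_reals all_analysis.
From mathcomp Require Import ring lra.
Import Order.TTheory GRing.Theory Num.Theory.
Import numFieldNormedType.Exports.
Local Open Scope classical_set_scope.
Local Open Scope ring_scope.

(** * Euclidean geometry, convex hulls and linear minimization *)

Section Euclidean.
Context {R : realType} {n : nat}.
Implicit Types (x y z c : 'rV[R]_n) (a : R).

Lemma dotC x y : dot x y = dot y x.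
Proof. by apply: eq_bigr => i _; rewrite mulrC. Qed.

Lemma dotDr x y z : dot x (y + z) = dot x y + dot x z.
Proof. by rewrite /dot -big_split; apply: eq_bigr => i _; rewrite mxE mulrDr. Qed.

Lemma dotZr a x y : dot x (a *: y) = a * dot x y.
Proof. by rewrite /dot mulr_sumr; apply: eq_bigr => i _; rewrite mxE mulrCA. Qed.

Lemma dotNr x y : dot x (- y) = - dot x y.
Proof. by rewrite -scaleN1r dotZr mulN1r. Qed.

Lemma dotBr x y z : dot x (y - z) = dot x y - dot x z.
Proof. by rewrite dotDr dotNr. Qed.

Lemma dot0r x : dot x 0 = 0.
Proof. by rewrite -(scale0r x) dotZr mul0r. Qed.

Lemma dotDl x y z : dot (x + y) z = dot x z + dot y z.
Proof. by rewrite dotC dotDr !(dotC z). Qed.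

Lemma dotZl a x y : dot (a *: x) y = a * dot x y.
Proof. by rewrite dotC dotZr dotC. Qed.

Lemma dotNl x y : dot (- x) y = - dot x y.
Proof. by rewrite dotC dotNr dotC. Qed.

Lemma dotBl x y z : dot (x - y) z = dot x z - dot y z.
Proof. by rewrite dotDl dotNl. Qed.

Lemma dot_sumr m x (p : 'I_m -> 'rV[R]_n) :
  dot x (\sum_i p i) = \sum_i dot x (p i).
Proof.
elim/big_rec2: _ => [|i a y _ <-]; first exact: dot0r.
by rewrite dotDr.
Qed.

Lemma dotxx_ge0 x : 0 <= dot x x.
Proof. by apply: sumr_ge0 => i _; rewrite -expr2 sqr_ge0. Qed.

Lemma norm2_ge0 x : 0 <= norm2 x.
Proof. exact: sqrtr_ge0. Qed.

Lemma sqr_norm2 x : norm2 x ^+ 2 = dot x x.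
Proof. exact/sqr_sqrtr/dotxx_ge0. Qed.

Lemma norm2_eq0 x : norm2 x = 0 -> x = 0.
Proof.
move=> x0; have /eqP : dot x x = 0 by rewrite -sqr_norm2 x0 expr0n.
rewrite psumr_eq0 => [/allP xi0|i _]; last by rewrite -expr2 sqr_ge0.
apply/rowP => i; rewrite mxE; apply/eqP.
by have := xi0 i (mem_index_enum i); rewrite -expr2 sqrf_eq0.
Qed.

Lemma norm20 : norm2 (0 : 'rV[R]_n) = 0.
Proof. by rewrite /norm2 dot0r sqrtr0. Qed.

Lemma norm2Z a x : norm2 (a *: x) = `|a| * norm2 x.
Proof. by rewrite /norm2 dotZl dotZr mulrA -expr2 sqrtrM ?sqr_ge0 ?sqrtr_sqr. Qed.

Lemma norm2N x : norm2 (- x) = norm2 x.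
Proof. by rewrite -scaleN1r norm2Z normrN1 mul1r. Qed.

(** Cauchy-Schwarz: expand the squared norm of [norm2 y *: x - norm2 x *: y] and cancel
    [norm2 x * norm2 y], which is positive once the zero cases are removed. *)
Lemma dot_le_norm2M x y : dot x y <= norm2 x * norm2 y.
Proof.
have [x0|x0] := eqVneq (norm2 x) 0.
  by rewrite (norm2_eq0 x x0) dotC dot0r norm20 mul0r.
have [y0|y0] := eqVneq (norm2 y) 0.
  by rewrite (norm2_eq0 y y0) dot0r norm20 mulr0.
have xy_gt0 : 0 < norm2 x * norm2 y.
  by rewrite mulr_gt0 ?lt0r ?x0 ?y0 ?norm2_ge0.
have := dotxx_ge0 (norm2 y *: x - norm2 x *: y).
rewrite !(dotBl, dotBr, dotZl, dotZr) (dotC y x) -!sqr_norm2 => h.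
rewrite -(ler_pM2l xy_gt0); nra.
Qed.

Lemma normr_dot x y : `|dot x y| <= norm2 x * norm2 y.
Proof.
rewrite ler_norml dot_le_norm2M andbT lerNl -dotNr.
by rewrite -(norm2N y) dot_le_norm2M.
Qed.

(** A [sup] bounds its set only if that set is bounded above. Compactness bounds the coordinates of
    points of [A] by some [M], so those of a difference by [2 * M]. *)
Lemma norm2_le_diam (A : set 'rV[R]_n) x y :
  topology_theory.compact.compact A -> A x -> A y -> norm2 (x - y) <= diam A.
Proof.
move=> /compact_bounded/ex_strict_bound_gt0[M M0 /= AM] Ax Ay.
have AMi z i : A z -> `|z ord0 i| <= M.
  move=> /AM/= /ltW; apply: le_trans.
  have -> : `|z| = mx_norm z by [].
  by rewrite mx_normrE (le_bigmax _ (fun ij => `|z ij.1 ij.2|) (ord0, i)).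
apply: ub_le_sup; last by exists x, y.
exists (Num.sqrt (\sum_(i < n) (2 * M) ^+ 2)) => _ [u [w [Au [Aw ->]]]].
rewrite ler_sqrt; last by apply: sumr_ge0 => i _; exact: sqr_ge0.
apply: ler_sum => i _; rewrite -expr2 -real_normK ?num_real//.
rewrite lerXn2r ?nnegrE ?mulr_ge0 ?(ltW M0)// !mxE.
by rewrite (le_trans (ler_normB _ _))// mulr_natl mulr2n lerD ?AMi.
Qed.

Lemma subset_convhull {A : set 'rV[R]_n} : A `<=` convhull A.
Proof.
move=> x Ax; exists 1%N, (fun=> 1), (fun=> x).
by rewrite !big_ord1 scale1r; split.
Qed.

Lemma argmin_lin_convhull {A : set 'rV[R]_n} c x y :
  is_argmin_lin A c x -> convhull A y -> dot c x <= dot c y.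
Proof.
move=> [_ cmin] [m [lam [p [lam0 [lam1 [Ap ->]]]]]].
rewrite dot_sumr -[leLHS]mul1r -lam1 mulr_suml.
by apply: ler_sum => i _; rewrite dotZr ler_wpM2l ?cmin.
Qed.

(* Strong convexity is applied at the midpoint of x and y, with the unit
   vector -c / |c|. *)
Lemma strongly_convex_set_gap {A : set 'rV[R]_n} (alpha : R) c x y :
  strongly_convex_set alpha (convhull A) -> convhull A x ->
  is_argmin_lin A c y ->
  alpha / 4 * norm2 (x - y) ^+ 2 * norm2 c <= dot c (x - y).
Proof.
move=> scA Ax ymin; have Ay := subset_convhull _ ymin.1.
have [c0|c0] := eqVneq (norm2 c) 0.
  by rewrite c0 mulr0 dotBr subr_ge0 (argmin_lin_convhull _ _ _ ymin).
have half01 : 0 <= (2^-1 : R) <= 1 by apply/andP; split; lra.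
have z1 : norm2 (- (norm2 c)^-1 *: c) <= 1.
  by rewrite norm2Z normrN ger0_norm ?invr_ge0 ?norm2_ge0// mulVf.
have := argmin_lin_convhull _ _ _ ymin (scA _ _ _ _ half01 Ax Ay z1).
rewrite !(dotDr, dotNr, dotZr) mulNr -sqr_norm2 expr2 mulKf//; lra.
Qed.

End Euclidean.

(** * First-order inequalities for smooth, convex and strongly convex functions *)

Section SmoothFunctions.
Context {R : realType} {n : nat} (f : 'rV[R]_n -> R) (gf : 'rV[R]_n -> 'rV[R]_n).
Context (Lf : R).
Hypotheses (fgf : is_gradient f gf) (gfL : lipschitz_grad Lf gf).
Implicit Types x y d : 'rV[R]_n.

Lemma is_derive_along_line x d (t : R) :
  is_derive t 1 (fun s : R => f (x + s *: d)) (dot (gf (x + t *: d)) d).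
Proof.
have [df dfE] := fgf (x + t *: d).
have E : (fun h : R => h^-1 *: ((fun s : R => f (x + s *: d)) (h *: 1 + t)
          - f (x + t *: d)))
       = (fun h : R => h^-1 *: (f (h *: d + (x + t *: d)) - f (x + t *: d))).
  apply/funext => h; congr (_ *: (f _ - _)).
  by rewrite -[h *: 1]/(h * 1) mulr1 scalerDl addrCA.
have dd := @diff_derivable _ _ _ f _ d df.
split; first by rewrite /derivable /shift /= E.
by rewrite /derive /shift /= E -dfE -deriveE.
Qed.

(** The mean value theorem on the segment replaces integration of the gradient: subtracting
    [Lf / 2 * K * t ^+ 2] makes the derivative [dg] nonpositive on the unit interval. The signs
    [a = 1] and [a = -1] give the two sides of the absolute value. *)
Lemma first_order_error x y :
  `|f y - f x - dot (gf x) (y - x)| <= Lf / 2 * norm2 (y - x) ^+ 2.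
Proof.
set d := y - x; set k := dot (gf x) d; set K := norm2 d ^+ 2.
have bound (a e : R) : a = 1 \/ a = -1 ->
    e = a * (f y - f x - k) - Lf / 2 * K -> e <= 0.
  move=> a1 ->.
  pose g t := a * (f (x + t *: d) - k * t) - Lf / 2 * K * t ^+ 2.
  pose dg t := a * (dot (gf (x + t *: d)) d - k) - Lf * K * t.
  have gP (t : R) : is_derive t 1 g (dg t).
    have := is_derive_along_line x d t => ?.
    rewrite /g /dg; apply: is_derive_eq.
    by rewrite !scaler1 /GRing.scale /=; field.
  have gcont : {within `[0, 1], continuous g}.
    apply: derivable_within_continuous => t _.
    exact: (ex_derive (is_derive := gP t)).
  have [c /andP[c0 c1]] := @MVT_segment _ g dg 0 1 ler01 (fun t _ => gP t) gcont.
  rewrite /g /dg scale1r scale0r addr0 [x + d]addrC subrK => E.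
  have : `|dot (gf (x + c *: d) - gf x) d| <= Lf * (c * norm2 d) * norm2 d.
    apply: le_trans (normr_dot _ _) _; rewrite ler_wpM2r ?norm2_ge0//.
    apply: le_trans (gfL _ _) _; rewrite addrAC subrr add0r norm2Z.
    by rewrite ger0_norm.
  rewrite dotBl -/k ler_norml => /andP[].
  move: E; rewrite /K; case: a1 => ->; lra.
have := bound 1 _ (or_introl erefl) erefl.
have := bound (-1) _ (or_intror erefl) erefl.
rewrite ler_norml; lra.
Qed.

Lemma ell_ge0 x y : 0 <= ell f gf x y.
Proof.
by rewrite /ell; case: ifP => // _; rewrite divr_ge0 ?exprn_ge0 ?norm2_ge0 ?mulr_ge0.
Qed.

Lemma ell_le x y : 0 <= Lf -> ell f gf x y <= Lf.
Proof.
move=> Lf0; rewrite /ell; case: eqP => // /eqP xy.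
have d0 : 0 < norm2 (y - x) ^+ 2.
  rewrite exprn_gt0// lt0r norm2_ge0 andbT; apply/eqP => /norm2_eq0/eqP.
  by rewrite subr_eq0 eq_sym (negPf xy).
rewrite ler_pdivrMr//; have := first_order_error x y; lra.
Qed.

Lemma le_ell x y :
  f y <= f x + dot (gf x) (y - x) + ell f gf x y / 2 * norm2 (y - x) ^+ 2.
Proof.
rewrite /ell; case: eqP => [->|/eqP xy].
  by rewrite subrr dot0r norm20 expr0n !mulr0 !addr0.
have d0 : norm2 (y - x) ^+ 2 != 0.
  rewrite expf_neq0//; apply/eqP => /norm2_eq0/eqP.
  by rewrite subr_eq0 eq_sym (negPf xy).
rewrite [_ / 2 * _]mulrAC divfK// [2 * _]mulrC mulfK//.
by have := ler_norm (f y - f x - dot (gf x) (y - x)); lra.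
Qed.

(** If the tangent exceeded [f y] by [e > 0], convexity at [x + s *: (y - x)] against the quadratic
    error would force [s * e <= s ^+ 2 * K], which fails for small [s]. *)
Lemma convex_fun_above_tangent x y : convex_fun f ->
  f x + dot (gf x) (y - x) <= f y.
Proof.
move=> cf; rewrite leNgt; apply/negP => lt_fy.
set e := f x + dot (gf x) (y - x) - f y.
have e0 : 0 < e by rewrite subr_gt0.
(* The sign of [Lf] is not known here; the absolute value makes [K] nonnegative. *)
set K := `|Lf / 2| * norm2 (y - x) ^+ 2.
have K0 : 0 <= K by rewrite mulr_ge0 ?exprn_ge0 ?norm2_ge0.
(* This choice gives [2 * (s * K) = e - s * e < e], contradicting [e <= s * K]. *)
pose s := e / (e + K + K).
have D0 : 0 < e + K + K by lra.
have s0 : 0 < s by exact: divr_gt0.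
have s1 : s <= 1 by rewrite ler_pdivrMr//; lra.
have sE : s * (e + K + K) = e by rewrite divfK// gt_eqF.
have s01 : 0 <= s <= 1 by rewrite ltW.
have := cf y x s s01.
have -> : s *: y + (1 - s) *: x = x + s *: (y - x).
  by rewrite scalerBl scale1r scalerBr addrC -addrA [- _ + _]addrC.
have := first_order_error x (x + s *: (y - x)).
rewrite (addrAC x) subrr add0r dotZr norm2Z (ger0_norm (ltW s0)) exprMn ler_norml.
move=> /andP[h1 _] h2.
have h3 : Lf / 2 * (s ^+ 2 * norm2 (y - x) ^+ 2) <= s ^+ 2 * K.
  rewrite mulrCA ler_wpM2l ?sqr_ge0// ler_wpM2r ?sqr_ge0//.
  exact: ler_norm.
have : s * e <= s * (s * K) by rewrite /e; lra.
rewrite ler_pM2l//; have : s * K + s * K <= e - s * e by lra.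
have : 0 < s * e by exact: mulr_gt0.
nra.
Qed.

(** The Polyak-Lojasiewicz inequality: complete the square in [gf x + mu *: (y - x)]. *)
Lemma strongly_convex_sqr_grad (mu : R) x y : 0 < mu ->
  strongly_convex_fun mu f gf -> 2 * mu * (f x - f y) <= norm2 (gf x) ^+ 2.
Proof.
move=> mu0 /(_ x y); move: (y - x) => d.
have := dotxx_ge0 (gf x + mu *: d).
rewrite !(dotDl, dotDr, dotZl, dotZr) (dotC d (gf x)) -!sqr_norm2 => h1 h2.
have := ler_wpM2l (ltW mu0) h2; lra.
Qed.

End SmoothFunctions.

(** * Scalar recursions that improve only at selected indices *)

(** The bound advances only at indices in [I]; elsewhere both it and the count stay put. As
    [iota 0 t] stops before [t], the count at the element [h_k] is exactly [k]. *)
Lemma count_rate {R : realType} (I : pred nat) (phi b : nat -> R) :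
  phi 0%N <= b 0%N -> (forall t, phi t.+1 <= phi t) ->
  (forall t k, I t -> phi t <= b k -> phi t.+1 <= b k.+1) ->
  forall t, phi t <= b (count I (iota 0 t)).
Proof.
move=> phi0 phiS phiI; elim=> // t IH.
rewrite -addn1 iotaD count_cat /= addn0 add0n addn1.
case It: (I t); rewrite ?addn0 ?addn1; first exact: phiI.
exact: le_trans (phiS t) IH.
Qed.

(* With w = sqrt p and K = sqrt C * c, the claim reads p' * (u + 1)^2 <= K^2
   given w * u <= K.  Either w * (u + 1) <= K already, or the decrease
   4 * m * (1 - s^2) * w is at least 4 / (u + 1) >= 1 - (u / (u + 1))^2. *)
Lemma inverse_square_step {R : realType} (C c m s u p p' : R) :
  0 < m -> 0 < s < 1 -> c = 1 / (1 - s) -> c <= u -> 0 <= p ->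
  ((1 + s) * m) ^- 2 <= C -> p <= C * c ^+ 2 / u ^+ 2 ->
  p' <= p * Num.max (s ^+ 2) (1 - (1 - s ^+ 2) * (4 * m * Num.sqrt p)) ->
  p' <= C * c ^+ 2 / (u + 1) ^+ 2.
Proof.
move=> m0 /andP[s0 s1] cE cu p0 mC.
have s1_gt0 : 0 < 1 - s by lra.
have cs : c * (1 - s) = 1 by rewrite cE divfK ?gt_eqF.
have c0 : 0 < c by rewrite cE divr_gt0.
have u0 : 0 < u by lra.
have ms0 : 0 < (1 + s) * m by rewrite mulr_gt0//; lra.
have C0 : 0 < C by apply: lt_le_trans mC; rewrite invr_gt0 exprn_gt0.
set w : R := Num.sqrt p; have w0 : 0 <= w by exact: sqrtr_ge0.
have pE : p = w ^+ 2 by rewrite sqr_sqrtr.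
set B : R := Num.sqrt C; have B0 : 0 <= B by exact: sqrtr_ge0.
have CE : C = B ^+ 2 by rewrite sqr_sqrtr// ltW.
have mB : 1 <= (1 + s) * m * B.
  rewrite -(@ler_pXn2r _ 2) ?nnegrE ?(mulr_ge0 (ltW ms0))//.
  rewrite expr1n exprMn -CE mulrC -ler_pdivrMr ?exprn_gt0//.
  by rewrite div1r.
set K : R := B * c; have K0 : 0 <= K by rewrite mulr_ge0 ?(ltW c0).
rewrite CE -exprMn -/K pE ler_pdivlMr ?exprn_gt0// -exprMn => wu.
have wu0 : 0 <= w * u by rewrite mulr_ge0 ?(ltW u0).
have wu1 : 0 <= w * (u + 1) by rewrite mulr_ge0// addr_ge0 ?(ltW u0).
rewrite ler_pdivlMr ?exprn_gt0 ?ltr_wpDr// => p'le.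
have u1 : 0 < (u + 1) ^+ 2 by rewrite exprn_gt0// ltr_wpDr.
apply: le_trans (ler_wpM2r (ltW u1) p'le) _.
rewrite maxr_pMr ?sqr_ge0// maxr_pMl ?(ltW u1)// ge_max; apply/andP; split.
  (* For the factor [s ^+ 2]: [c <= u] gives [1 <= u * (1 - s)], hence [s * (u + 1) <= u]. *)
  apply: le_trans wu; rewrite -!exprMn -mulrA mulrCA mulrA.
  have sw0 : 0 <= s * (w * (u + 1)) by rewrite mulr_ge0 ?(ltW s0).
  rewrite -mulrA ler_pXn2r ?nnegrE//.
  rewrite mulrCA ler_wpM2l//; nra.
have a0 : 0 <= (1 - s ^+ 2) * (4 * m).
  by rewrite mulr_ge0 ?mulr_ge0 ?(ltW m0)//; nra.
have [wK|Kw] := leP (w * (u + 1)) K.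
  have : (w * (u + 1)) ^+ 2 <= K ^+ 2.
    by rewrite ler_pXn2r ?nnegrE.
  apply: le_trans; rewrite exprMn ler_wpM2r ?(ltW u1)//.
  rewrite ler_piMr ?sqr_ge0// mulrA.
  by have := mulr_ge0 a0 w0; lra.
have aw : 4 <= (1 - s ^+ 2) * (4 * m) * (w * (u + 1)).
  apply: le_trans (ler_wpM2l a0 (ltW Kw)).
  have -> : (1 - s ^+ 2) * (4 * m) * K = 4 * ((1 + s) * m * B) * (c * (1 - s)).
    by rewrite /K; ring.
  by rewrite cs; lra.
apply: le_trans wu; rewrite exprMn -mulrA ler_wpM2l ?sqr_ge0//.
have := ler_wpM2r (ltW (ltr_wpDr ler01 u0)) aw.
move: aw; nra.
Qed.

(** * Invariants and one-step progress of the algorithm *)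

Section Run.
Context {R : realType} {n : nat} {A : set 'rV[R]_n} {alpha : R}.
Context {f : 'rV[R]_n -> R} {gf : 'rV[R]_n -> 'rV[R]_n} {Lf : R}.
Context {xstar xm1 : 'rV[R]_n} {r : nat -> R} {eta : R}.
Context {x v : nat -> 'rV[R]_n} {L : nat -> R}.
Hypotheses (alpha0 : 0 < alpha) (scA : strongly_convex_set alpha (convhull A)).
Hypotheses (cf : convex_fun f) (fgf : is_gradient f gf).
Hypotheses (Lf0 : 0 < Lf) (gfL : lipschitz_grad Lf gf).
Hypotheses (xmin : is_minimizer f (convhull A) xstar).
Hypotheses (r01 : forall t, 0 < r t <= 1) (run : ACFW_run f gf A r xm1 x v L).

Let gap t := dot (gf (x t)) (x t - v t).
Let step t := stepsize (L t) (x t - v t) (gap t).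

Lemma run_L_bound t : 0 <= L t <= Lf.
Proof.
have [_ _ L0 rec] := run; elim: t => [|t /andP[IH0 IH1]].
  by rewrite L0 ell_ge0 (ell_le _ _ _ fgf gfL) ?ltW.
have [_ -> _] := rec t; have /andP[rt0 rt1] := r01 t.
rewrite le_max ell_ge0/= ge_max (ell_le _ _ _ fgf gfL) ?(ltW Lf0)//=.
by rewrite (le_trans _ IH1)// ler_piMl.
Qed.

Lemma run_step_itv t : 0 <= gap t -> 0 <= step t <= 1.
Proof.
move=> g0; rewrite /step /stepsize; case: ifP => _; first by rewrite ler01 lexx.
have /andP[Lt0 _] := run_L_bound t.
by rewrite le_min ler01 ge_min lexx orbT !andbT divr_ge0 ?(mulr_ge0 Lt0 (sqr_ge0 _)).
Qed.

Lemma run_in_convhull t : convhull A (x t).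
Proof.
have [_ x0min _ rec] := run; elim: t => [|t IH].
  exact: subset_convhull x0min.1.
have [vmin _ ->] := rec t; case: ifP => // _.
have g0 : 0 <= gap t.
  by rewrite /gap dotBr subr_ge0 (argmin_lin_convhull _ _ _ vmin).
have /andP[st0 st1] := run_step_itv t g0.
have st01 : 0 <= 1 - step t <= 1 by apply/andP; split; lra.
(* Taking [z = 0] in strong convexity yields plain convexity of the hull. *)
have z1 : norm2 (0 : 'rV[R]_n) <= 1 by rewrite norm20.
have := scA _ _ _ _ st01 IH (subset_convhull _ vmin.1) z1.
rewrite scaler0 addr0 subKr scalerBl scale1r => XS.
rewrite -/(gap t) -/(step t) scalerBr opprB.
by have -> : x t + (step t *: v t - step t *: x t)
          = x t - step t *: x t + step t *: v t by rewrite addrCA addrC.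
Qed.

Lemma run_gap_ge t : f (x t) - f xstar <= gap t.
Proof.
have [_ _ _ /(_ t)[vmin _ _]] := run.
have := argmin_lin_convhull _ _ _ vmin xmin.1.
have := convex_fun_above_tangent _ _ _ fgf gfL (x t) xstar cf.
by rewrite /gap !dotBr; lra.
Qed.

Lemma run_error_ge0 t : 0 <= f (x t) - f xstar.
Proof. by rewrite subr_ge0; apply: xmin.2; exact: run_in_convhull. Qed.

Lemma run_nonincreasing t : f (x t.+1) <= f (x t).
Proof.
have [_ _ _ /(_ t)[_ _ ->]] := run.
by case: ifP => // /ltW.
Qed.

(** The point [x 0] minimizes the linearization of [f] at [xm1], whose value at [xstar] is at most
    [f xstar]; only the quadratic error between [xm1] and [x 0] remains. *)
Lemma run_init : topology_theory.compact.compact A ->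
  f (x 0%N) - f xstar <= Lf * diam A ^+ 2 / 2.
Proof.
move=> cA; have [Axm1 x0min _ _] := run.
have /(ler_normlW) := first_order_error _ _ _ fgf gfL xm1 (x 0%N).
have := argmin_lin_convhull _ _ _ x0min xmin.1.
have := convex_fun_above_tangent _ _ _ fgf gfL xm1 xstar cf.
have : Lf / 2 * norm2 (x 0%N - xm1) ^+ 2 <= Lf / 2 * diam A ^+ 2.
  rewrite ler_wpM2l ?divr_ge0 ?(ltW Lf0)// lerXn2r ?nnegrE ?norm2_ge0//.
    by apply: le_trans (norm2_ge0 (x 0%N - xm1)) _; exact: norm2_le_diam x0min.1 _.
  exact: norm2_le_diam x0min.1 _.
by rewrite !dotBr; lra.
Qed.

Lemma run_contraction t : 1 < eta < 2 -> inI eta L t ->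
  f (x t.+1) - f xstar <= (f (x t) - f xstar) *
    Num.max (eta / 2) (1 - (1 - eta / 2) * (alpha * norm2 (gf (x t)) / (4 * Lf))).
Proof.
move=> /andP[eta1 eta2] It; set a := alpha * _ / _.
have [_ _ _ /(_ t)[vmin LS xS]] := run.
have phi0 := run_error_ge0 t; have gapphi := run_gap_ge t.
have g0 := le_trans phi0 gapphi.
have /andP[Lt0 LtLf] := run_L_bound t.
set d := x t - v t in LS xS; rewrite -/(gap t) -/(step t) in LS xS.
set xb := x t - step t *: d in LS xS.
(* The acceptance test keeps the better of [x t] and [xb]. *)
have fS : f (x t.+1) <= f xb by rewrite xS; case: ltP.
have fxb : f xb <= f (x t) - step t * gap t
                  + eta / 2 * (L t * norm2 d ^+ 2) * step t ^+ 2.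
  apply: le_trans (le_ell _ gf (x t) _) _.
  have -> : xb - x t = - step t *: d by rewrite /xb addrAC subrr add0r scaleNr.
  rewrite dotZr -/(gap t) norm2Z exprMn real_normK ?num_real// sqrrN.
  have ellE : ell f gf (x t) xb <= eta * L t.
    by apply: le_trans It; rewrite LS le_max lexx.
  have := ler_wpM2r (mulr_ge0 (sqr_ge0 (step t)) (sqr_ge0 (norm2 d))) ellE.
  by lra.
have ng0 : 0 <= norm2 (gf (x t)) := norm2_ge0 _.
have a0 : 0 <= a by rewrite divr_ge0 ?mulr_ge0 ?(ltW alpha0) ?(ltW Lf0).
set P := L t * norm2 d ^+ 2 in fxb *.
have P0 : 0 <= P by rewrite mulr_ge0 ?sqr_ge0.
(* Since [L t <= Lf], strong convexity of the hull makes [a] a lower bound for the unclipped step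
   [gap t / P]. *)
have aP : a * P <= gap t.
  have := strongly_convex_set_gap _ _ _ _ scA (run_in_convhull t) vmin.
  apply: le_trans; rewrite -/d.
  have -> : alpha / 4 * norm2 d ^+ 2 * norm2 (gf (x t)) = a * (Lf * norm2 d ^+ 2).
    by rewrite /a; field; rewrite gt_eqF.
  by rewrite ler_wpM2l// ler_wpM2r ?sqr_ge0.
rewrite maxr_pMr// le_max.
move: fxb; rewrite {1 2}/step /stepsize -/d -/P.
(* With [P = 0] the step defaults to 1 and the quadratic term vanishes, so the decrease is at least
   the whole gap and the new error is at most 0. *)
have [PE|PN] := eqVneq P 0.
  rewrite PE => fxb; apply/orP; left.
  by have : 0 <= (f (x t) - f xstar) * (eta / 2); nra.
have Pgt0 : 0 < P by rewrite lt0r PN.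
(* A clipped step has [P < gap t], so it gains at least [(1 - eta / 2) * gap t], which gives the
   factor [eta / 2]. An unclipped step [s] gains [(1 - eta / 2) * (s * gap t)]. *)
case: (leP (gap t / P) 1) => [gP|Pg] fxb; last first.
  apply/orP; left; move: Pg; rewrite ltr_pdivlMr// mul1r => Pg.
  by nra.
apply/orP; right; set s := gap t / P in gP fxb.
have sP : s * P = gap t by rewrite divfK.
have as_ : a <= s by rewrite ler_pdivlMr.
have : (1 - eta / 2) * (a * (f (x t) - f xstar)) <= (1 - eta / 2) * (s * gap t).
  by apply: ler_wpM2l; [lra | exact: ler_pM].
have : eta / 2 * P * s ^+ 2 = eta / 2 * (s * gap t) by rewrite -sP; ring.
by lra.
Qed.

End Run.

(** * Both rates, from the contraction and the counting argument *)

Theorem theorem3 (R : realType) (n : nat) (A : set 'rV[R]_n) (alpha : R)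
    (f : 'rV[R]_n -> R) (gf : 'rV[R]_n -> 'rV[R]_n) (Lf : R) (xstar : 'rV[R]_n)
    (r : nat -> R) (eta : R) (xm1 : 'rV[R]_n) (x v : nat -> 'rV[R]_n) (L : nat -> R) :
  topology_theory.compact.compact A ->
  0 < alpha -> strongly_convex_set alpha (convhull A) ->
  convex_fun f -> is_gradient f gf -> 0 < Lf -> lipschitz_grad Lf gf ->
  is_minimizer f (convhull A) xstar ->
  condD r -> ACFW_run f gf A r xm1 x v L ->
  1 < eta < 2 ->
  (forall mu : R, 0 < mu -> strongly_convex_fun mu f gf ->
     forall t s : nat, is_h eta L t s ->
       f (x s) - f xstar <=
         Num.max (Lf * diam A ^+ 2 / 2)
                 (18 * (1 / (1 + Num.sqrt (eta / 2))) ^+ 2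
                     * (alpha * Num.sqrt mu / (8 * Num.sqrt 2 * Lf)) ^- 2)
         * (1 / (1 - Num.sqrt (eta / 2))) ^+ 2
         / (t%:R + 1 / (1 - Num.sqrt (eta / 2))) ^+ 2) /\
  (forall g : R, 0 < g -> (forall y, convhull A y -> g <= norm2 (gf y)) ->
     forall t s : nat, is_h eta L t s ->
       f (x s) - f xstar <=
         Lf * diam A ^+ 2 / 2
         * (Num.max (eta / 2) (1 - (1 - eta / 2) * (alpha * g / (8 * Lf)))) ^+ t).
Proof.
move=> cA alpha0 scA cf fgf Lf0 gfL xmin [r01 _] run eta12.
have /andP[eta1 eta2] := eta12.
have init := run_init cf fgf Lf0 gfL xmin run cA.
have contr t := run_contraction alpha0 scA cf fgf Lf0 gfL xmin r01 run t eta12.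
have err0 := run_error_ge0 scA fgf Lf0 gfL xmin r01 run.
have mono t : f (x t.+1) - f xstar <= f (x t) - f xstar.
  by rewrite lerD2r; exact: run_nonincreasing run t.
split => [mu mu0 scf t u [_ <-] | g g0 gmin t u [_ <-]].
- set s := Num.sqrt (eta / 2); set c := 1 / (1 - s).
  set m := alpha * _ / _; set C := Num.max _ _.
  have sE : s ^+ 2 = eta / 2 by rewrite sqr_sqrtr//; lra.
  have s01 : 0 < s < 1.
    apply/andP; split; first by rewrite sqrtr_gt0; lra.
    by rewrite -[ltRHS]sqrtr1 ltr_sqrt//; lra.
  have /andP[s0 s1] := s01.
  have c0 : 0 < c by rewrite divr_gt0//; lra.
  have m0 : 0 < m by rewrite divr_gt0 ?mulr_gt0 ?sqrtr_gt0.
  (* The second entry of the maximum is 18 times the left side. *)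
  have mC : ((1 + s) * m) ^- 2 <= C.
    rewrite /C le_max; apply/orP; right.
    rewrite exprMn invfM div1r exprVn -mulrA ler_peMl ?ler1n//.
    by rewrite mulr_ge0 ?invr_ge0 ?sqr_ge0.
  (* The shift by [c] makes the bound equal to [C] at [k = 0], where [run_init] applies; each
     counted step then moves [u = k%:R + c] to [u + 1]. *)
  apply: (count_rate (inI eta L) (fun t => f (x t) - f xstar)
           (fun k => C * c ^+ 2 / (k%:R + c) ^+ 2)) => // [|{}t k It le_k].
    by rewrite add0r mulfK ?expf_neq0 ?gt_eqF// (le_trans init)// le_max lexx.
  rewrite -natr1 addrAC.
  apply: (inverse_square_step C c m s _ (f (x t) - f xstar)) => //.
    by rewrite lerDr.
  apply: le_trans (contr t It) _; rewrite ler_wpM2l// sE.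
  rewrite ge_max !le_max lexx/=; apply/orP; right.
  rewrite lerD2l lerN2 ler_wpM2l//; first lra.
  (* Because [4 / (8 * sqrt 2) = sqrt 2 / 4], the constant in [m] is the one produced by bounding
     the gradient norm below by [sqrt (2 * mu * phi)], with [phi] the current error. *)
  have -> : 4 * m * Num.sqrt (f (x t) - f xstar)
          = alpha * Num.sqrt (2 * mu * (f (x t) - f xstar)) / (4 * Lf).
    have s2 : Num.sqrt 2 != 0 :> R by rewrite gt_eqF// sqrtr_gt0.
    have s22 : Num.sqrt 2 ^+ 2 = 2 :> R by rewrite sqr_sqrtr.
    rewrite !sqrtrM ?mulr_ge0 ?(ltW mu0)// /m.
    set p := Num.sqrt (f (x t) - f xstar).
    apply: (mulIf s2).
    rewrite -[RHS](_ : alpha * (Num.sqrt 2 ^+ 2 * Num.sqrt mu * p) / (4 * Lf) = _).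
      by rewrite s22; field; rewrite s2 gt_eqF.
    by ring.
  rewrite ler_wpM2r ?invr_ge0 ?mulr_ge0 ?(ltW Lf0)// ler_wpM2l ?(ltW alpha0)//.
  rewrite -[leRHS]ger0_norm ?norm2_ge0// -sqrtr_sqr ler_sqrt ?sqr_ge0//.
  exact: strongly_convex_sqr_grad.
- set q := Num.max _ _.
  have q0 : 0 <= q by rewrite le_max; apply/orP; left; lra.
  apply: (count_rate (inI eta L) (fun t => f (x t) - f xstar)
           (fun k => Lf * diam A ^+ 2 / 2 * q ^+ k)) => // [|{}t k It le_k].
    by rewrite expr0 mulr1.
  apply: le_trans (contr t It) _; rewrite (exprSr q) [leRHS]mulrA.
  have gle := gmin _ (run_in_convhull scA fgf Lf0 gfL r01 run t).
  apply: (@le_trans _ _ ((f (x t) - f xstar) * q)); last by rewrite ler_wpM2r.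
  rewrite ler_wpM2l// /q ge_max !le_max lexx/=; apply/orP; right.
  rewrite lerD2l lerN2 ler_wpM2l//; first lra.
  (* The contraction has denominator [4 * Lf] and the target [8 * Lf]; over the common [8 * Lf] it
     remains that [g] is at most twice the gradient norm. *)
  rewrite -[leRHS](_ : alpha * (2 * norm2 (gf (x t))) / (8 * Lf) = _).
    rewrite ler_wpM2r ?invr_ge0 ?mulr_ge0 ?(ltW Lf0)// ler_wpM2l ?(ltW alpha0)//.
    lra.
  by field; rewrite gt_eqF.
Qed.
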